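(* Let $p$ be an odd prime and let $\mathbf{e}=(e_1,\dots,e_{p-1})\in\mathbb{F}_p^{p-1}$ be a non-constant vector. Then the GGS-group $G$ with defining vector $\mathbf{e}$ has the congruence subgroup property.
   Context: Fix an odd prime $p$. Let $X=\{1,\dots,p\}$ and let $T$ be the regular rooted tree whose vertices are the words in the free monoid $X^*$, with $u,v$ joined by an edge if $v=ux$ or $u=vx$ for some $x\in X$. $L_n$ is the set of words of length $n$. $\operatorname{Aut} T$ is the group of automorphisms of $T$ and $\operatorname{st}(n)$ is the stabilizer of all vertices of $L_n$; for $G\le \operatorname{Aut}T$, $\operatorname{st}_G(n)=G\cap\operatorname{st}(n)$. For $g$ fixing a vertex $v$, $g_v\in\operatorname{Aut}T$ denotes the restriction of $g$ to the subtree rooted at $v$ (identified with $T$), i.e. $g(vw)=v\,g_v(w)$; $\psi:\operatorname{st}(1)\to \operatorname{Aut}T\times\overset{p}{\cdots}\times\operatorname{Aut}T$ is the isomorphism $g\mapsto(g_1,\dots,g_p)$. For a non-zero vector $\mathbf{e}=(e_1,\dots,e_{p-1})\in\mathbb{F}_p^{p-1}$, the GGS-group with defining vector $\mathbf{e}$ is $G=\langle a,b\rangle\le\operatorname{Aut}T$, where $a$ is the rooted automorphism given by $a(xv)=\sigma(x)v$ for $x\in X$, $v\in X^*$, with $\sigma=(1\;2\;\dots\;p)$, and $b\in\operatorname{st}(1)$ is recursively defined by $\psi(b)=(a^{e_1},a^{e_2},\dots,a^{e_{p-1}},b)$. The vector is non-constant if its entries $e_1,\dots,e_{p-1}$ are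 not all equal. A subgroup $G\le\operatorname{Aut}T$ has the congruence subgroup property if every finite index subgroup of $G$ contains $\operatorname{st}_G(n)$ for some $n$. *)

(* Defs.v *)
From HB Require Import structures.
From mathcomp Require Import all_boot all_order all_algebra all_classical.

Set Implicit Arguments.
Unset Strict Implicit.
Unset Printing Implicit Defensive.

Local Open Scope classical_set_scope.
Local Open Scope group_scope.

Section Subgroups.
Variable gT : groupType.
Implicit Types G H A : set gT.

Definition is_subgroup H := group_closed (mem H).

Definition generated A : set gT := smallest is_subgroup A.

Definition finite_index G H :=
  finite_set [set [set g * h | h in H] | g in G].

End Subgroups.

Section Tree.
Variable p : nat.

(* The alphabet {1, ..., p} is 'I_p, so the letter written i : 'I_p is i + 1. *)
Definition word := seq 'I_p.

Definition adjacent (u v : word) : bool :=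
  [exists x : 'I_p, (v == rcons u x) || (u == rcons v x)].

(* Graph automorphisms. They automatically fix the root [::], which is the only
   vertex of degree p, the others having degree p + 1. *)
Record autT := AutT {
  aut_fun :> word -> word;
  aut_inv : word -> word;
  aut_funK : cancel aut_fun aut_inv;
  aut_invK : cancel aut_inv aut_fun;
  aut_adj : forall u v, adjacent (aut_fun u) (aut_fun v) = adjacent u v }.

HB.instance Definition _ := gen_eqMixin autT.
HB.instance Definition _ := gen_choiceMixin autT.

Lemma autT_eqP (g h : autT) : g =1 h -> g = h.
Proof.
case: g h => [f f' fK f'K fA] [k k' kK k'K kA] /= /funext fk.
move: kK k'K kA; rewrite -{}fk => kK k'K kA.
have f'k' : f' = k' by apply: funext => u; rewrite -{1}(k'K u) fK.
move: kK k'K; rewrite -f'k' => kK k'K.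
by rewrite (Prop_irrelevance fK kK) (Prop_irrelevance f'K k'K)
           (Prop_irrelevance fA kA).
Qed.

Definition aut_one : autT :=
  @AutT id id (fun=> erefl) (fun=> erefl) (fun _ _ => erefl).

Lemma aut_mul_adj (g h : autT) u v :
  adjacent ((g \o h) u) ((g \o h) v) = adjacent u v.
Proof. by rewrite /= !aut_adj. Qed.

Definition aut_mul (g h : autT) : autT :=
  @AutT (g \o h) (aut_inv h \o aut_inv g)
        (can_comp (@aut_funK g) (@aut_funK h))
        (can_comp (@aut_invK h) (@aut_invK g))
        (aut_mul_adj g h).

Lemma aut_inv_adj (g : autT) u v :
  adjacent (aut_inv g u) (aut_inv g v) = adjacent u v.
Proof. by rewrite -(aut_adj g) !aut_invK. Qed.

Definition aut_opp (g : autT) : autT :=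
  AutT (@aut_invK g) (@aut_funK g) (aut_inv_adj g).

Lemma aut_mulA : associative aut_mul.
Proof. by move=> f g h; apply: autT_eqP. Qed.
Lemma aut_mul1g : left_id aut_one aut_mul.
Proof. by move=> g; apply: autT_eqP. Qed.
Lemma aut_mulg1 : right_id aut_one aut_mul.
Proof. by move=> g; apply: autT_eqP. Qed.
Lemma aut_mulVg : left_inverse aut_one aut_opp aut_mul.
Proof. by move=> g; apply: autT_eqP => u; rewrite /= aut_funK. Qed.
Lemma aut_mulgV : right_inverse aut_one aut_opp aut_mul.
Proof. by move=> g; apply: autT_eqP => u; rewrite /= aut_invK. Qed.

HB.instance Definition _ :=
  isGroup.Build autT aut_mulA aut_mul1g aut_mulg1 aut_mulVg aut_mulgV.

Definition level (n : nat) : set word := [set v | size v = n].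

Definition level_stab (n : nat) : set autT :=
  [set g | forall v, level n v -> g v = v].

Definition congruence_subgroup_property (G : set autT) :=
  forall H : set autT, is_subgroup H -> H `<=` G -> finite_index G H ->
    exists n, G `&` level_stab n `<=` H.

Lemma adjacentC (u v : word) : adjacent u v = adjacent v u.
Proof. by apply: eq_existsb => x; rewrite orbC. Qed.

Lemma adjacent_nil (v : word) : adjacent [::] v = (size v == 1)%N.
Proof.
apply/existsP/idP => [[x /orP[/eqP->|]]|]; rewrite ?size_rcons //.
  by case: v.
by case: v => [|x []] // _; exists x; rewrite eqxx.
Qed.

Lemma adjacent_cons (x y : 'I_p) (u v : word) :
  adjacent (x :: u) (y :: v) = (x == y) && adjacent u v.
Proof.
apply/existsP/andP => [[z]|[/eqP-> /existsP[z Hz]]].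
  rewrite /= !eqseq_cons [y == x]eq_sym.
  by rewrite -andb_orr => /andP[-> h]; split=> //; apply/existsP; exists z.
by exists z; rewrite !rcons_cons !eqseq_cons eqxx.
Qed.

Definition rooted_fun (s : 'I_p -> 'I_p) (w : word) : word :=
  if w is x :: v then s x :: v else [::].

Lemma rooted_fun_adj s (s_inj : injective s) u v :
  adjacent (rooted_fun s u) (rooted_fun s v) = adjacent u v.
Proof.
case: u v => [|x u] [|y v] //=; rewrite ?adjacent_nil //.
  by rewrite adjacentC [RHS]adjacentC !adjacent_nil.
by rewrite !adjacent_cons (inj_eq s_inj).
Qed.

Lemma rooted_funK s t : cancel s t -> cancel (rooted_fun s) (rooted_fun t).
Proof. by move=> st [|x v] //=; rewrite st. Qed.

(* ordS is the cyclic successor on 'I_p, i.e. the p-cycle (1 2 ... p). *)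
Definition ggs_a : autT :=
  AutT (rooted_funK (@ordSK p)) (rooted_funK (@ord_predK p))
       (rooted_fun_adj (can_inj (@ordSK p))).

Section B.
Variable e : 'rV['F_p]_(p.-1).

(* Exponents in 'F_p are represented by their values in {0, ..., p - 1}, which
   is harmless since ggs_a has order p. The partial map insub : 'I_p -> 'I_p.-1
   is undefined exactly at the last letter. *)
Fixpoint ggs_b_fun (w : word) : word :=
  if w is x :: v then
    x :: (if insub (val x) is Some i then (ggs_a ^+ e ord0 i) v
          else ggs_b_fun v)
  else [::].

Fixpoint ggs_b_inv (w : word) : word :=
  if w is x :: v then
    x :: (if insub (val x) is Some i then (ggs_a ^- e ord0 i) v
          else ggs_b_inv v)
  else [::].

Lemma ggs_b_funK : cancel ggs_b_fun ggs_b_inv.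
Proof.
elim=> [|x v IH] //=; congr cons.
by case: insub => [i|] //; apply: aut_funK.
Qed.

Lemma ggs_b_invK : cancel ggs_b_inv ggs_b_fun.
Proof.
elim=> [|x v IH] //=; congr cons.
by case: insub => [i|] //; apply: aut_invK.
Qed.

Lemma ggs_b_adj u v : adjacent (ggs_b_fun u) (ggs_b_fun v) = adjacent u v.
Proof.
have nilE x w : adjacent [::] (ggs_b_fun (x :: w)) = adjacent [::] (x :: w).
  rewrite !adjacent_nil /= !eqSS.
  case: insub => [i|]; last by case: w.
  have -> n (t : word) : size ((ggs_a ^+ n) t) = size t; last by [].
  elim: n t => [|n IHn] t; first by [].
  rewrite expgS -[RHS]IHn /=; by case: ((ggs_a ^+ n) t).
elim: u v => [|x u IH] [|y v] //.
  by rewrite adjacentC [RHS]adjacentC; exact: nilE.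
rewrite /= !adjacent_cons; case: eqVneq => // <- /=.
by case: insub => [i|] //; apply: aut_adj.
Qed.

Definition ggs_b : autT := AutT ggs_b_funK ggs_b_invK ggs_b_adj.

(* The equation psi(b) = (a^{e_1}, ..., a^{e_{p-1}}, b), coordinate by coordinate. *)
Lemma ggs_b_cons (x : 'I_p) (i : 'I_p.-1) w :
  x = i :> nat -> ggs_b (x :: w) = x :: (ggs_a ^+ e ord0 i) w.
Proof. by move=> xi /=; rewrite xi valK. Qed.

Lemma ggs_b_cons_last (x : 'I_p) w :
  x = p.-1 :> nat -> ggs_b (x :: w) = x :: ggs_b w.
Proof. by move=> xp /=; rewrite xp insubN // ltnn. Qed.

Definition ggs : set autT := generated [set ggs_a; ggs_b].

End B.
End Tree.

Definition nonconstant (p n : nat) (e : 'rV['F_p]_n) :=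
  exists i j, e ord0 i != e ord0 j.

(* Main.v *)
Require Import Defs.
From mathcomp Require Import all_boot all_order all_algebra all_classical ring.

(* Write gamma_n for the lower central series of G and b_i for the conjugate of
   b by a power of a having b below the letter i. A product of conjugates b_i
   fixing level 2 gives a polynomial r over F_p with r e = 0 modulo
   X^p - 1 = (X - 1)^p, where e is extended by 0 at the place of b; this extension
   is not constant, so (X - 1)^2 divides r, and this says exactly that the product
   lies in gamma_3. Next, gamma_4 contains a copy of
   gamma_3 below each letter: commutators of products of the b_i with almost
   disjoint supports isolate one letter, in two different ways according to
   whether e is geometric along the multiples of some m. Since gamma_3 projects
   onto gamma_2 and gamma_2 onto G below a letter, [gamma_3, gamma_3] contains a
   copy of gamma_4 below each word of length 2, and hence the stabilizer of
   level 5. Finally, if g moves v and lies in a normal subgroup N, then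
   [[x, g], y] = [x, y] for x, y living below v, up to inverting x, so that N
   contains a copy of [gamma_3, gamma_3] below each word of the length of v. This
   applies to the normal core N of a subgroup of finite index, unless N = 1, in
   which case G is finite. *)

Set Implicit Arguments.
Unset Strict Implicit.
Unset Printing Implicit Defensive.

Import GRing.Theory.
Local Open Scope classical_set_scope.
Local Open Scope group_scope.

(** * Subgroups, commutators and congruences in an abstract group *)

Section AbstractGroups.
Variable gT : groupType.
Implicit Types (G H K N A B : set gT) (x y z g : gT).

Lemma is_subgroupP H :
  is_subgroup H <->
  [/\ H 1, forall x y, H x -> H y -> H (x * y) & forall x, H x -> H x^-1].
Proof.
split=> [hH|[h1 hM hV]].
  have h1 : H 1 by case: hH => h _; rewrite -inE.
  split=> // [x y /mem_set hx /mem_set hy|x /mem_set hx]; apply/set_mem.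
    exact: (group_closedM hH).
  exact: (group_closedV hH).
split; first exact/mem_set.
by move=> x y /set_mem hx /set_mem hy; apply/mem_set/hM/hV.
Qed.

Lemma subgroup1 H : is_subgroup H -> H 1.
Proof. by case/is_subgroupP. Qed.

Lemma subgroupM H x y : is_subgroup H -> H x -> H y -> H (x * y).
Proof. by case/is_subgroupP => _ + _; apply. Qed.

Lemma subgroupV H x : is_subgroup H -> H x -> H x^-1.
Proof. by case/is_subgroupP => _ _; apply. Qed.

Lemma subgroupX H x n : is_subgroup H -> H x -> H (x ^+ n).
Proof.
move=> sH hx; elim: n => [|n IHn]; first exact: subgroup1.
by rewrite expgS; apply: subgroupM.
Qed.

Lemma subgroupJ H x y : is_subgroup H -> H x -> H y -> H (x ^ y).
Proof. by move=> sH hx hy; do !apply: subgroupM => //; apply: subgroupV. Qed.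

Lemma subgroupR H x y : is_subgroup H -> H x -> H y -> H [~ x, y].
Proof.
by move=> sH hx hy; apply: subgroupM => //; [apply: subgroupV|apply: subgroupJ].
Qed.

Lemma generated_subgroup A : is_subgroup (generated A).
Proof.
apply/is_subgroupP; split=> [H [sH _]|x y hx hy H sAH|x hx H sAH].
- exact: subgroup1.
- by apply: subgroupM; [case: sAH|apply: hx|apply: hy].
- by apply: subgroupV; [case: sAH|apply: hx].
Qed.

Lemma sub_generated A : A `<=` generated A.
Proof. by move=> x hx H [_]; apply. Qed.

Lemma generated_sub A H : is_subgroup H -> A `<=` H -> generated A `<=` H.
Proof. by move=> sH sAH x; apply. Qed.

Definition normalizes G N := forall x g, G g -> N x -> N (x ^ g).

Definition commutators A B : set gT :=
  generated [set z | exists x y, [/\ A x, B y & z = [~ x, y]]].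

Lemma commutators_subgroup A B : is_subgroup (commutators A B).
Proof. exact: generated_subgroup. Qed.

Lemma mem_commutators A B x y : A x -> B y -> commutators A B [~ x, y].
Proof. by move=> hx hy; apply: sub_generated; exists x, y. Qed.

Lemma commutators_sub A B H :
  is_subgroup H -> (forall x y, A x -> B y -> H [~ x, y]) ->
  commutators A B `<=` H.
Proof. by move=> sH h; apply: generated_sub => // _ [x [y [hx hy ->]]]; apply: h. Qed.

Lemma commutators_normal G A B :
  normalizes G A -> normalizes G B -> normalizes G (commutators A B).
Proof.
move=> nA nB x g hg.
suff: commutators A B `<=` [set y | commutators A B (y ^ g)] by move=> h; apply: h.
apply: commutators_sub => [|y z hy hz /=]; last first.
  by rewrite conjRg; apply: mem_commutators; [apply: nA|apply: nB].
have sC := commutators_subgroup A B.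
apply/is_subgroupP; split=> /= [|y z hy hz|y hy].
- by rewrite conj1g; apply: subgroup1 sC.
- by rewrite conjMg; apply: subgroupM sC _ _.
- by rewrite conjVg; apply: subgroupV sC _.
Qed.

Lemma subgroup_normalizes G : is_subgroup G -> normalizes G G.
Proof. by move=> sG x g hg hx; apply: subgroupJ. Qed.

(** For N normal in G, this is the preimage of a centralizer in G/N; with [eqmod] below, it avoids
    forming quotient groups. *)
Definition centralizer_mod G N B : set gT :=
  [set x | G x /\ forall y, B y -> N [~ x, y]].

Lemma commMgJ x y z : [~ x * y, z] = [~ x, z] ^ y * [~ y, z].
Proof. by rewrite !commgEr conjgM mulgA -conjMg mulgK. Qed.

Lemma commVgJ x y : [~ x^-1, y] = ([~ x, y]^-1) ^ x^-1.
Proof.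
have := commMgJ x x^-1 y; rewrite mulgV comm1g => /esym/mulg1_eq <-.
by rewrite conjVg.
Qed.

Lemma centralizer_mod_subgroup G N B :
  is_subgroup G -> is_subgroup N -> normalizes G N ->
  is_subgroup (centralizer_mod G N B).
Proof.
move=> sG sN nN; apply/is_subgroupP; split.
- split=> [|y _]; first exact: subgroup1.
  by rewrite comm1g; apply: subgroup1.
- move=> x y [hx cx] [hy cy]; split=> [|z hz]; first exact: subgroupM.
  by rewrite commMgJ; apply: subgroupM; [|apply: nN; [|apply: cx]|apply: cy].
- move=> x [hx cx]; split=> [|z hz]; first exact: subgroupV.
  rewrite commVgJ; apply: nN; first exact: subgroupV.
  by apply: subgroupV => //; apply: cx.
Qed.

Lemma centralizer_mod_normal G N B :
  is_subgroup G -> normalizes G N -> normalizes G B ->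
  normalizes G (centralizer_mod G N B).
Proof.
move=> sG nN nB x g hg [hx cx]; split=> [|y hy]; first exact: subgroupJ.
rewrite -[y](conjgKV g) -conjRg; apply: nN => //; apply: cx.
by apply: nB => //; apply: subgroupV.
Qed.

Lemma commutatorC N x y : is_subgroup N -> N [~ x, y] -> N [~ y, x].
Proof. by move=> sN /(subgroupV sN); rewrite invgR. Qed.

(** The elements of G commuting modulo N with a given set form a subgroup; this is applied to one
    argument, then to the other. *)
Lemma generated_commutator G N A B :
  is_subgroup G -> is_subgroup N -> normalizes G N -> A `<=` G -> B `<=` G ->
  (forall x y, A x -> B y -> N [~ x, y]) ->
  forall x y, generated A x -> generated B y -> N [~ x, y].
Proof.
move=> sG sN nN sAG sBG h x y hx hy.
have hA b : B b -> N [~ b, x].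
  move=> hb; apply: commutatorC => //.
  suff [] : centralizer_mod G N B x by move=> _; apply.
  apply: (generated_sub (centralizer_mod_subgroup B sG sN nN)) hx => z hz.
  by split; [apply: sAG|move=> w; apply: h].
apply: commutatorC => //.
suff [] : centralizer_mod G N [set x] y by move=> _; apply.
apply: (generated_sub (centralizer_mod_subgroup _ sG sN nN)) hy => z hz.
by split=> [|_ ->]; [apply: sBG|apply: hA].
Qed.

Lemma commutators_subl G N : is_subgroup N -> normalizes G N ->
  commutators N G `<=` N.
Proof.
move=> sN nN; apply: commutators_sub => // x g hx hg.
by rewrite commgEl; apply: subgroupM => //; [apply: subgroupV|apply: nN].
Qed.

Definition eqmod N x y := N (x^-1 * y).

Lemma eqmod_refl N x : is_subgroup N -> eqmod N x x.
Proof. by move=> sN; rewrite /eqmod mulVg; apply: subgroup1. Qed.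

Lemma eqmod_trans N y x z :
  is_subgroup N -> eqmod N x y -> eqmod N y z -> eqmod N x z.
Proof.
move=> sN xy yz; rewrite /eqmod -(mulgK y x^-1) -mulgA.
by apply: subgroupM.
Qed.

Lemma eqmodM G N x x' y y' : is_subgroup N -> normalizes G N -> G y ->
  eqmod N x x' -> eqmod N y y' -> eqmod N (x * y) (x' * y').
Proof.
move=> sN nN hy xx yy.
rewrite /eqmod (_ : _ * _ = (x^-1 * x') ^ y * (y^-1 * y')).
  by apply: subgroupM => //; apply: nN.
by rewrite conjgE invgM !mulgA mulgK.
Qed.

Lemma eqmodJ G N x y g : normalizes G N -> G g ->
  eqmod N x y -> eqmod N (x ^ g) (y ^ g).
Proof. by move=> nN hg xy; rewrite /eqmod -conjVg -conjMg; apply: nN. Qed.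

Lemma eqmodC N x y : N [~ y, x] -> eqmod N (x * y) (y * x).
Proof. by rewrite /eqmod invgM -!mulgA. Qed.

Lemma eqmod1 N x y : is_subgroup N -> eqmod N x y -> N y -> N x.
Proof.
move=> sN xy hy; rewrite -(invgK x) -(mulgK y x^-1); apply: subgroupV => //.
by apply: subgroupM => //; apply: subgroupV.
Qed.

End AbstractGroups.

(** * Tree automorphisms preserve length and prefixes *)

Section TreeAutomorphisms.
Variable p : nat.
Implicit Types (g h k : autT p) (u v w : word p).

Lemma autM g h w : (g * h) w = g (h w). Proof. by []. Qed.
Lemma autK g : cancel g (g^-1)%g. Proof. exact: aut_funK. Qed.
Lemma autKV g : cancel (g^-1)%g g. Proof. exact: aut_invK. Qed.
Lemma aut_inj g : injective g. Proof. exact: can_inj (autK g). Qed.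

(* The root has p neighbours, any other vertex has p + 1. *)
Lemma aut_nil g : g [::] = [::].
Proof.
case/lastP E: (g [::]) => [|v y] //.
pose nb (o : option 'I_p) := if o is Some x then rcons (rcons v y) x else v.
have adj o : adjacent [::] ((g^-1)%g (nb o)).
  rewrite -(aut_adj g) autKV E; apply/existsP.
  by case: o => [x|]; [exists x|exists y]; rewrite /= eqxx ?orbT.
have nb_inj : injective nb.
  move=> [x|] [z|] //=; first by move/rcons_inj => [->].
  - by move/(congr1 size)/eqP; rewrite !size_rcons -addn2 -[X in _ == X]addn0 eqn_add2l.
  - by move/(congr1 size)/eqP; rewrite !size_rcons -addn2 -[X in X == _]addn0 eqn_add2l.
pose hd o := head y ((g^-1)%g (nb o)).
have: injective hd.
  move=> o o' /= eq_hd; apply: nb_inj; apply: (@aut_inj (g^-1)%g).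
  move: (adj o) (adj o') eq_hd; rewrite /hd !adjacent_nil.
  by case: ((g^-1)%g _) => [|a []] //; case: ((g^-1)%g _) => [|c []] //= _ _ ->.
by move/leq_card; rewrite card_option card_ord ltnn.
Qed.

(** By adjacency the image is a child of [g u] or its parent; by induction the parent is already the
    image of the parent of [u], so injectivity excludes it. *)
Lemma aut_rcons g u x : exists y, g (rcons u x) = rcons (g u) y.
Proof.
have step w z : adjacent (g w) (g (rcons w z)).
  by rewrite aut_adj; apply/existsP; exists z; rewrite eqxx.
elim/last_ind: u x => [|u y IH] x.
  move: (step [::] x); rewrite aut_nil adjacent_nil.
  by case: (g _) => [|a []] // _; exists a.
have [z gz] := IH y.
case/existsP: (step (rcons u y) x) => t /orP[/eqP ->|/eqP]; first by exists t.
rewrite gz => /rcons_inj [] /aut_inj /(congr1 size)/eqP.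
by rewrite !size_rcons -addn2 -[X in X == _]addn0 eqn_add2l.
Qed.

Lemma size_aut g u : size (g u) = size u.
Proof.
elim/last_ind: u => [|u x IH]; first by rewrite aut_nil.
by have [y ->] := aut_rcons g u x; rewrite !size_rcons IH.
Qed.

Lemma take_aut g n u : g (take n u) = take n (g u).
Proof.
elim/last_ind: u => [|u x IH]; first by rewrite aut_nil.
have [y gy] := aut_rcons g u x.
have [le_un|lt_nu] := leqP (size (rcons u x)) n.
  by rewrite !take_oversize ?size_aut.
move: lt_nu; rewrite size_rcons ltnS => le_nu.
by rewrite gy -!cats1 !takel_cat ?size_aut // cats1.
Qed.

Lemma prefix_aut g u v : prefix (g u) (g v) = prefix u v.
Proof.
rewrite !prefixE size_aut -take_aut; apply/eqP/eqP => [/aut_inj|->] //.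
Qed.

Lemma level_stab_le m n : (m <= n)%N -> @level_stab p n `<=` @level_stab p m.
Proof.
move=> le_mn g hg v hv; have [x0|no] := pselect (exists x : 'I_p, True).
  case: x0 => x _; have := hg (v ++ nseq (n - m) x).
  rewrite /level /= size_cat size_nseq hv subnKC // => /(_ erefl).
  move/(congr1 (take (size v))); rewrite -take_aut take_size_cat //.
case: v hv => [|x v] hv; first by rewrite aut_nil.
by case: no; exists x.
Qed.

Lemma level_stab_all g : (forall n, level_stab n g) -> g = 1.
Proof. by move=> h; apply: autT_eqP => v; apply: (h (size v)). Qed.

Definition supported_below v g := forall u, ~~ prefix v u -> g u = u.

Lemma supported_below_commute v w g h : size v = size w -> v != w ->
  supported_below v g -> supported_below w h -> g * h = h * g.
Proof.
move=> eq_sz neq_vw gv hw; apply: autT_eqP => u; rewrite !autM.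
have key v' w' g' h' : size v' = size w' -> v' != w' -> supported_below v' g' ->
    supported_below w' h' -> prefix v' u -> g' (h' u) = h' (g' u).
  move=> sz neq gv' hw' pu.
  have nprefix t : prefix v' t -> ~~ prefix w' t.
    rewrite !prefixE -sz => /eqP ->; exact: neq.
  rewrite (hw' u) ?nprefix // hw' ?nprefix //.
  apply/negPn/negP => npu; case/negP: (npu).
  by rewrite (aut_inj (gv' _ npu)).
have [pv|npv] := boolP (prefix v u); first exact: (key v w).
have [pw|npw] := boolP (prefix w u).
  by apply/esym/(key w v) => //; rewrite eq_sym.
by rewrite (gv u) // (hw u) // gv.
Qed.

Lemma supported_belowJ v g h :
  supported_below v g -> supported_below ((h^-1)%g v) (g ^ h).
Proof.
move=> gv u nu; rewrite !autM gv ?autK //.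
by apply: contra nu => pu; rewrite -(prefix_aut h) autKV.
Qed.

End TreeAutomorphisms.

(** * Powers with exponents in F_p *)

Section Exponents.
Variables (p : nat) (p_prime : prime p) (gT : groupType) (x : gT).
Hypothesis xp : x ^+ p = 1.

Lemma expg_modp n : x ^+ (n %% p) = x ^+ n.
Proof. by rewrite [in RHS](divn_eq n p) expgnDr mulnC expgnA xp expg1n mul1g. Qed.

Lemma expg_Fp_nat n : x ^+ (n%:R : 'F_p)%R = x ^+ n.
Proof. by rewrite val_Fp_nat // expg_modp. Qed.

Lemma expg_FpD (k l : 'F_p) : x ^+ (k + l)%R = x ^+ k * x ^+ l.
Proof. by rewrite -expgnDr -(expg_Fp_nat (k + l)%N) natrD !natr_Zp. Qed.

Lemma expg_FpM (k l : 'F_p) : x ^+ (k * l)%R = (x ^+ k) ^+ l.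
Proof. by rewrite -expgnA -(expg_Fp_nat (k * l)%N) natrM !natr_Zp. Qed.

Lemma expg_FpN (k : 'F_p) : x ^+ (- k)%R = (x ^+ k)^-1.
Proof. by apply/esym/mulg1_eq; rewrite -expg_FpD subrr. Qed.

End Exponents.

(** * Elements of st(1) and their sections *)

Section Sections.
Variables (p : nat) (p_prime : prime p).
Implicit Types (h k : 'F_p -> autT p) (i j : 'F_p) (c : 'I_p) (x y : autT p).

(* Letters are numbered by 'F_p in order to compute with them. *)
Definition Fp_of_letter c : 'F_p := (c%:R)%R.
Definition letter i : 'I_p := cast_ord (Fp_cast p_prime) i.

Lemma letterK : cancel letter Fp_of_letter.
Proof. by move=> i; rewrite /Fp_of_letter /= natr_Zp. Qed.

Lemma Fp_of_letterK : cancel Fp_of_letter letter.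
Proof. by move=> c; apply: val_inj; rewrite /= val_Fp_nat ?modn_small. Qed.

Definition node_fun h (w : word p) : word p :=
  if w is c :: v then c :: h (Fp_of_letter c) v else [::].

Lemma node_funK h k : (forall i, cancel (h i) (k i)) ->
  cancel (node_fun h) (node_fun k).
Proof. by move=> hK [|x v] //=; rewrite hK. Qed.

Lemma node_fun_adj h u v :
  adjacent (node_fun h u) (node_fun h v) = adjacent u v.
Proof.
case: u v => [|x u] [|y v] //=; rewrite ?adjacent_nil /= ?size_aut //.
  by rewrite adjacentC [RHS]adjacentC !adjacent_nil /= size_aut.
by rewrite !adjacent_cons; case: eqVneq => // <-; rewrite aut_adj.
Qed.

(** This is the inverse of psi, with coordinates indexed by ['F_p]. *)
Definition node h : autT p :=
  AutT (@node_funK h (fun i => (h i)^-1) (fun i => autK (h i)))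
       (@node_funK (fun i => (h i)^-1) h (fun i => autKV (h i)))
       (node_fun_adj h).

Lemma node_cons h i w : node h (letter i :: w) = letter i :: h i w.
Proof. by rewrite /= letterK. Qed.

Lemma eq_node h k : h =1 k -> node h = node k.
Proof. by move=> hk; apply: autT_eqP => -[|x w] //=; rewrite hk. Qed.

Lemma nodeM h k : node h * node k = node (fun i => h i * k i).
Proof. by apply: autT_eqP => -[]. Qed.

Lemma node1 : node (fun=> 1) = 1.
Proof. by apply: autT_eqP => -[]. Qed.

Lemma nodeV h : (node h)^-1 = node (fun i => (h i)^-1).
Proof. by apply: autT_eqP => -[]. Qed.

Lemma nodeJ h k : node h ^ node k = node (fun i => h i ^ k i).
Proof. by rewrite /conjg !(nodeM, nodeV). Qed.

Lemma nodeR h k : [~ node h, node k] = node (fun i => [~ h i, k i]).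
Proof. by rewrite /commg nodeV nodeJ nodeM. Qed.

Lemma nodeX h n : node h ^+ n = node (fun i => h i ^+ n).
Proof.
elim: n => [|n IHn]; first by rewrite node1.
by rewrite expgS IHn nodeM; apply: eq_node => i; rewrite expgS.
Qed.

Lemma node_level_stab h n :
  level_stab n.+1 (node h) -> forall i, level_stab n (h i).
Proof.
move=> hn i v hv; have := hn (letter i :: v).
by rewrite node_cons /level /= hv => /(_ erefl) [].
Qed.

Definition single i (k : autT p) := node (fun j => if j == i then k else 1).

Lemma singleM i : {morph single i : x y / x * y}.
Proof.
move=> x y; rewrite /single nodeM; apply: eq_node => j /=.
by case: (j == i); rewrite ?mulg1.
Qed.

Lemma single1 i : single i 1 = 1.
Proof. by rewrite -[RHS]node1; apply: eq_node => j /=; case: eqP. Qed.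

Lemma singleV i x : single i x^-1 = (single i x)^-1.
Proof. by apply/esym/mulg1_eq; rewrite -singleM mulgV single1. Qed.

Lemma singleJ i x h : single i x ^ node h = single i (x ^ h i).
Proof.
by rewrite nodeJ; apply: eq_node => j /=; case: eqP => [->|]; rewrite ?conj1g.
Qed.

Lemma singleR i x h : [~ single i x, node h] = single i [~ x, h i].
Proof. by rewrite commgEl singleJ -singleV -singleM. Qed.

Lemma single_preim_subgroup i (H : set (autT p)) :
  is_subgroup H -> is_subgroup [set x | H (single i x)].
Proof.
move=> sH; apply/is_subgroupP; split=> /= [|x y hx hy|x hx].
- by rewrite single1; apply: subgroup1 sH.
- by rewrite singleM; apply: subgroupM.
- by rewrite singleV; apply: subgroupV.
Qed.

Lemma node_mem (H : set (autT p)) h :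
  is_subgroup H -> (forall i, H (single i (h i))) -> H (node h).
Proof.
move=> sH hH; suff key (s : seq 'F_p) :
    uniq s -> H (node (fun j => if j \in s then h j else 1)).
  have := key (enum 'F_p) (enum_uniq _); congr (H _); apply: eq_node => j.
  by rewrite mem_enum.
elim: s => [_|i s IH /= /andP[nis us]].
  by rewrite (eq_node (k := fun=> 1)) // node1; apply: subgroup1.
rewrite (_ : node _ = single i (h i) * node (fun j => if j \in s then h j else 1)).
  by apply: subgroupM => //; apply: IH.
rewrite nodeM; apply: eq_node => j; rewrite inE; case: eqVneq => [->|] /=.
  by rewrite (negbTE nis) mulg1.
by rewrite mul1g.
Qed.

Definition single_word (v : word p) (k : autT p) : autT p :=
  foldr (fun c => single (Fp_of_letter c)) k v.

Lemma single_wordM v : {morph single_word v : x y / x * y}.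
Proof. by move=> x y; elim: v => //= a v ->; rewrite singleM. Qed.

Lemma single_word1 v : single_word v 1 = 1.
Proof. by elim: v => //= c v ->; rewrite single1. Qed.

Lemma single_wordV v x : single_word v x^-1 = (single_word v x)^-1.
Proof. by elim: v => //= a v ->; rewrite singleV. Qed.

Lemma single_wordR v : {morph single_word v : x y / [~ x, y]}.
Proof. by move=> x y; rewrite /commg /conjg !(single_wordM, single_wordV). Qed.

Lemma single_supported v x : supported_below v (single_word v x).
Proof.
elim: v x => [|a v IH] x u /=; first by rewrite prefix0s.
case: u => [|c u] //=.
rewrite (can_eq Fp_of_letterK) [c == a]eq_sym; case: eqVneq => [<-|] //= nu.
by rewrite IH.
Qed.

End Sections.

(** * The GGS-group, the conjugates of b and normal forms *)

Section GGS.
Variables (p : nat) (p_prime : prime p).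
Variable e : 'rV['F_p]_(p.-1).
Notation a := (ggs_a p).
Notation b := (ggs_b e).
Notation G := (ggs e).
Notation letter := (letter p_prime).
Implicit Types (i j k : 'F_p) (n : nat).

(* The vector e extended by 0 to all of 'F_p, its entry e_k being at k. *)
Definition exponent k : 'F_p :=
  if insub (val (k - 1)%R) is Some i then e ord0 i else 0%R.
Notation f := exponent.

Lemma val_FpN1 : val (-1 : 'F_p)%R = p.-1.
Proof.
have -> : (-1 : 'F_p)%R = (p.-1%:R)%R.
  apply/eqP; rewrite -subr_eq0 -opprD oppr_eq0 -(natrD _ 1) add1n prednK ?prime_gt0 //.
  by rewrite pchar_Fp_0.
by rewrite /= val_Fp_nat // modn_small // prednK ?prime_gt0.
Qed.

Lemma exponent0 : f 0%R = 0%R.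
Proof. by rewrite /exponent sub0r val_FpN1 insubF // ltnn. Qed.

Lemma exponentS (i : 'I_p.-1) : f (i.+1%:R)%R = e ord0 i.
Proof.
rewrite /exponent -natr1 addrK /= val_Fp_nat // modn_small ?valK //.
by rewrite (leq_trans (ltn_ord i)) // leq_pred.
Qed.

Lemma ordS_letter i : ordS (letter i) = letter (i + 1)%R.
Proof.
apply: val_inj; rewrite -[i in RHS]natr_Zp natr1 [RHS]/= val_Fp_nat //.
Qed.

Lemma ggs_aX_letter n i w : (a ^+ n) (letter i :: w) = letter (i + n%:R)%R :: w.
Proof.
elim: n => [|n IHn]; first by rewrite addr0.
by rewrite expgS autM IHn -natr1 addrA -ordS_letter.
Qed.

Lemma ggs_aX_p : a ^+ p = 1.
Proof.
apply: autT_eqP => -[|c w]; first by rewrite aut_nil.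
by rewrite -(Fp_of_letterK p_prime c) ggs_aX_letter pchar_Fp_0 // addr0.
Qed.

Lemma node_conj_aX h n : node h ^ (a ^+ n) = node (fun i => h (i + n%:R)%R).
Proof.
apply/eqP; rewrite -(inj_eq (mulgI (a ^+ n))) -conjgC; apply/eqP/autT_eqP.
case=> [|c w]; first by rewrite !aut_nil.
rewrite -(Fp_of_letterK p_prime c) !autM (node_cons _ _ _ w) ggs_aX_letter.
by rewrite !(node_cons, ggs_aX_letter).
Qed.

(** Letters being numbered from 0, the section b stands at p - 1 = -1 and a^(e_k) at k - 1, whence
    the shift in the argument of [f]. *)
Lemma ggs_b_node : b = node (fun j => if j == (-1)%R then b else a ^+ f (j + 1)%R).
Proof.
apply: autT_eqP => -[|c w] //.
rewrite -(Fp_of_letterK p_prime c) node_cons; set i := Fp_of_letter c.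
rewrite /= /exponent addrK.
case: insubP => [t _ vt|nt].
  suff -> : (i == -1)%R = false by [].
  by apply/eqP => ei; move: (ltn_ord t); rewrite vt ei val_FpN1 ltnn.
suff -> : (i == -1)%R by [].
rewrite -val_eqE val_FpN1 eqn_leq [(p.-1 <= _)%N]leqNgt.
have lt_ip : (i < p)%N by rewrite -[X in (_ < X)%N](Fp_cast p_prime).
by rewrite nt andbT -ltnS prednK ?prime_gt0.
Qed.

Lemma ggs_bX_p : b ^+ p = 1.
Proof.
apply: autT_eqP; elim=> [|c w IH]; first by rewrite aut_nil.
rewrite ggs_b_node nodeX -(Fp_of_letterK p_prime c) node_cons.
case: eqP => _; first by rewrite IH.
by rewrite -expgnA mulnC expgnA ggs_aX_p expg1n.
Qed.

(** Conjugation by a^n moves a section from j + n to j, so the exponent -1 - i brings the section b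
    from -1 to i. *)
Definition beta i : autT p := b ^ (a ^+ (-1 - i)%R).

Definition beta_section i j := if j == i then b else a ^+ f (j - i)%R.

Lemma beta_node i : beta i = node (beta_section i).
Proof.
rewrite /beta ggs_b_node node_conj_aX; apply: eq_node => j.
rewrite natr_Zp /beta_section (_ : j + (-1 - i) = j - i - 1)%R; last by ring.
by rewrite subrK -subr_eq0 opprK subrK subr_eq0.
Qed.

Lemma beta_N1 : beta (-1)%R = b.
Proof. by rewrite /beta subrr conjg1. Qed.

Lemma beta_conj_aX i n : beta i ^ (a ^+ n) = beta (i - n%:R)%R.
Proof.
rewrite !beta_node node_conj_aX; apply: eq_node => j; rewrite /beta_section.
have jni : (j + n%:R - i = j - (i - n%:R))%R by ring.
by rewrite -(subr_eq0 (j + _)%R) jni subr_eq0.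
Qed.

Lemma betaX_p i : beta i ^+ p = 1.
Proof. by rewrite /beta -conjXg ggs_bX_p conj1g. Qed.

Lemma ggs_subgroup : is_subgroup G. Proof. exact: generated_subgroup. Qed.
Hint Resolve ggs_subgroup : core.
Lemma ggs_mem_a : G a. Proof. by apply: sub_generated; left. Qed.
Lemma ggs_mem_b : G b. Proof. by apply: sub_generated; right. Qed.
Lemma ggs_mem_aX n : G (a ^+ n).
Proof. exact: (subgroupX _ ggs_subgroup ggs_mem_a). Qed.

Lemma ggs_mem_beta i : G (beta i).
Proof. exact: (subgroupJ ggs_subgroup ggs_mem_b (ggs_mem_aX _)). Qed.

(** Conjugation by a permutes the [beta i], so powers of a can be collected on the left; inverses
    are rewritten as (p - 1)-th powers. *)
Lemma ggs_form g : G g -> exists n s, g = a ^+ n * \prod_(i <- s) beta i.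
Proof.
pose F := [set g | exists n s, g = a ^+ n * \prod_(i <- s) beta i].
have prodJ s n : (\prod_(i <- s) beta i) ^ (a ^+ n) =
    \prod_(i <- [seq (i - n%:R)%R | i <- s]) beta i.
  by rewrite conjg_prod big_map; apply: eq_bigr => i _; rewrite beta_conj_aX.
have prodV s : exists t, (\prod_(i <- s) beta i)^-1 = \prod_(i <- t) beta i.
  elim: s => [|i s [t IH]]; first by exists [::]; rewrite big_nil invg1.
  exists (t ++ nseq p.-1 i); rewrite big_cons invgM IH big_cat /=; congr (_ * _).
  apply: mulg1_eq; rewrite big_nseq iter_mulg_1 -expgS prednK ?prime_gt0 //.
  exact: betaX_p.
suff : is_subgroup F.
  move=> sF; apply: (generated_sub sF) => _ [->|->].
    by exists 1%N, [::]; rewrite big_nil mulg1.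
  by exists 0%N, [:: (-1)%R]; rewrite big_seq1 beta_N1 mul1g.
apply/is_subgroupP; split.
- by exists 0%N, [::]; rewrite big_nil mulg1.
- move=> _ _ [n [s ->]] [m [t ->]].
  exists (n + m)%N, ([seq (i - m%:R)%R | i <- s] ++ t).
  by rewrite big_cat /= -prodJ expgnDr conjgE !mulgA mulgK.
- move=> _ [n [s ->]]; have [t tE] := prodV s.
  exists (n * p.-1)%N, [seq (i - (n * p.-1)%N%:R)%R | i <- t].
  rewrite -prodJ -conjgC invgM tE; congr (_ * _); apply: mulg1_eq.
  by rewrite -expgnDr -mulnS prednK ?prime_gt0 // mulnC expgnA ggs_aX_p expg1n.
Qed.

Lemma prod_beta_node s : \prod_(i <- s) beta i =
  node (fun j => \prod_(i <- s) beta_section i j).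
Proof.
elim: s => [|i s IH].
  by rewrite big_nil -[LHS]node1; apply: eq_node => j; rewrite big_nil.
rewrite big_cons IH beta_node nodeM; apply: eq_node => j.
by rewrite big_cons.
Qed.

Lemma ggs_mem_beta_section i j : G (beta_section i j).
Proof.
by rewrite /beta_section; case: eqP => _; [apply: ggs_mem_b|apply: ggs_mem_aX].
Qed.

Lemma ggs_mem_prod (s : seq 'F_p) (F : 'F_p -> autT p) :
  (forall i, G (F i)) -> G (\prod_(i <- s) F i).
Proof.
move=> GF; elim: s => [|i s IH].
  by rewrite big_nil; apply: (subgroup1 ggs_subgroup).
by rewrite big_cons; apply: (subgroupM ggs_subgroup).
Qed.

Lemma level_stab1_form g : G g -> level_stab 1 g ->
  exists s, g = \prod_(i <- s) beta i.
Proof.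
move=> Gg; have [n [s ->]] := ggs_form Gg => g1; exists s.
(* On level 1 the product of the [beta i] is trivial and a^n translates by n, so n vanishes modulo
   p. *)
have := g1 [:: letter 0%R] erefl.
rewrite autM prod_beta_node node_cons aut_nil ggs_aX_letter => -[E].
have {E} : letter (0 + n%:R)%R = letter 0%R by apply: val_inj.
move/(can_inj (letterK p_prime)); rewrite add0r => n0.
by rewrite -(expg_Fp_nat p_prime ggs_aX_p) n0 mul1g.
Qed.

End GGS.

(** * Polynomials in the shift annihilating a function on F_p *)

Section Annihilator.
Local Open Scope ring_scope.
Variables (p : nat) (p_prime : prime p) (f : 'F_p -> 'F_p).

Lemma Fp_shift_const : (forall i, f (i + 1) = f i) -> forall i, f i = f 0.
Proof.
move=> fS i; rewrite -[i]natr_Zp; elim: (i : nat) => [|n IH] //.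
by rewrite -natr1 fS.
Qed.

(** The size is p, written as in the definition of ['F_p] so that matrix indices are elements of the
    field. *)
Let shift_mx : 'M['F_p]_((Zp_trunc (pdiv p)).+2) :=
  \matrix_(i, j) ((i : 'F_p) == (j : 'F_p) - 1)%:R.
Let f_row : 'rV['F_p]_((Zp_trunc (pdiv p)).+2) := \row_j f j.

Lemma shift_mxE (v : 'rV_((Zp_trunc (pdiv p)).+2)) (j : 'F_p) :
  (v *m shift_mx) 0 j = v 0 (j - 1 : 'F_p).
Proof.
rewrite mxE (bigD1 (j - 1 : 'F_p)) //= big1 ?addr0 => [|i neq].
  by rewrite mxE eqxx mulr1.
by rewrite mxE (negbTE neq) mulr0.
Qed.

Lemma shift_mxXE n (j : 'F_p) : (f_row *m shift_mx ^+ n) 0 j = f (j - n%:R).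
Proof.
elim: n j => [|n IHn] j; first by rewrite mulmx1 mxE subr0.
by rewrite exprSr mulmxA shift_mxE IHn -natr1 opprD addrAC addrA.
Qed.

(* The polynomials annihilating f, with X acting as the shift, form an ideal
   containing X ^ p - 1 = (X - 1) ^ p; as f is not constant, this ideal is
   contained in the one generated by (X - 1) ^ 2. *)
Lemma annihilator_double_root (r : {poly 'F_p}) :
  (exists i, f i != f 0) -> f_row *m horner_mx shift_mx r = 0 ->
  ('X - 1) ^+ 2 %| r.
Proof.
move=> [i0 fi0] r0.
(* In characteristic p, (X - 1)^p = X^p - 1, and p shifts compose to the identity. *)
have q0 : f_row *m horner_mx shift_mx (('X - 1) ^+ p) = 0.
  have -> : ('X - 1) ^+ p = 'X^p - 1 :> {poly 'F_p}.
    have chp : p \in [pchar {poly 'F_p}] by rewrite pchar_poly pchar_Fp.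
    rewrite -!(pFrobenius_autE chp) pFrobenius_autB_comm ?pFrobenius_aut1 //.
    exact: mulrC.
  rewrite rmorphB rmorph1 rmorphXn /= horner_mx_X mulmxBr; apply/eqP; rewrite subr_eq0.
  apply/eqP/rowP => j; rewrite shift_mxXE mulmx1 mxE pchar_Fp_0 // subr0 //.
have mul0 (u v : {poly 'F_p}) : f_row *m horner_mx shift_mx u = 0 ->
    f_row *m horner_mx shift_mx (v * u) = 0.
  by move=> u0; rewrite mulrC rmorphM /= -mulmxE mulmxA u0 mul0mx.
(* The gcd of r and (X - 1)^p is (X - 1)^k up to a unit, and it annihilates f by Bezout. *)
have [[u v] /= /eqp_dvdl uv] := Bezoutp r (('X - 1) ^+ p).
have : gcdp r (('X - 1) ^+ p) %| ('X - 1%:P) ^+ p by rewrite dvdp_gcdr.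
case/dvdp_exp_XsubCP => k le_kp gk.
have k0 : f_row *m horner_mx shift_mx (('X - 1) ^+ k) = 0.
  have : u * r + v * ('X - 1) ^+ p %| ('X - 1) ^+ k.
    by rewrite uv (eqp_dvdl _ gk).
  case/dvdpP => w ->; apply: (mul0); rewrite rmorphD /= mulmxDr !mul0 ?addr0 //.
(* If k were at most 1, X - 1 would annihilate f, making f invariant under the shift, hence
   constant. *)
have le2k : (2 <= k)%N.
  rewrite ltnNge; apply/negP => le_k1; case/eqP: fi0.
  apply: Fp_shift_const => i.
  have := mul0 _ (('X - 1) ^+ (1 - k)) k0; rewrite -exprD subnK // expr1.
  rewrite rmorphB rmorph1 /= horner_mx_X mulmxBr mulmx1 => /eqP.
  rewrite subr_eq0 => /eqP/rowP/(_ (i + 1)).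
  by rewrite shift_mxE !mxE addrK.
apply: dvdp_trans (dvdp_gcdl r (('X - 1) ^+ p)).
by rewrite (eqp_dvdr _ gk) dvdp_exp2l.
Qed.

(** The hypothesis says that r, the sum of the X^i for i in s, annihilates f; its double root at 1
    gives r(1) = 0 and r'(1) = 0, the two conclusions. *)
Lemma annihilator_sums (s : seq 'F_p) : (exists i, f i != f 0) ->
  (forall j, \sum_(i <- s) f (j - i) = 0) ->
  (size s)%:R = 0 :> 'F_p /\ \sum_(i <- s) i = 0.
Proof.
move=> fnc fs; pose r : {poly 'F_p} := \sum_(i <- s) 'X^(i : nat).
have : ('X - 1) ^+ 2 %| r.
  apply: annihilator_double_root => //; apply/rowP => j.
  rewrite rmorph_sum /= mulmx_sumr summxE mxE -[RHS](fs j); apply: eq_bigr => i _.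
  by rewrite rmorphXn /= horner_mx_X shift_mxXE natr_Zp.
have X1 : ('X - 1 : {poly 'F_p}).[1] = 0 by rewrite !hornerE subrr.
case/dvdpP => q rE; split.
  have := congr1 (horner^~ 1) rE; rewrite hornerM horner_exp X1 expr0n mulr0.
  rewrite /r horner_sum => <-; rewrite (eq_bigr (fun=> 1)) => [|i _].
    by rewrite big_const_seq count_predT iter_addr_0.
  by rewrite hornerXn expr1n.
have : r^`().[1] = 0.
  by rewrite rE expr2 mulrA derivM hornerD !hornerM X1 !(mul0r, mulr0) addr0.
move=> r'1; rewrite -[RHS]r'1 /r raddf_sum /= horner_sum; apply: eq_bigr => i _.
by rewrite derivXn hornerMn hornerXn expr1n natr_Zp.
Qed.

End Annihilator.

(** * Lower central series and the stabilizer of level 2 *)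

Section GGSLowerCentral.
Variables (p : nat) (p_prime : prime p) (p_odd : odd p).
Variable e : 'rV['F_p]_(p.-1).
Notation a := (ggs_a p).
Notation b := (ggs_b e).
Notation G := (ggs e).
Notation letter := (letter p_prime).
Notation f := (exponent e).
Notation beta := (beta e).
Implicit Types (i j k : 'F_p) (n : nat).
(** The index 0 is excluded because [f] takes there the added value 0; the condition concerns the
    entries of [e] alone. *)
Hypothesis f_nonconstant :
  exists k l : 'F_p, [/\ k != 0, l != 0 & f k != f l]%R.

Definition gamma2 := commutators G G.
Definition gamma3 := commutators gamma2 G.
Definition gamma4 := commutators gamma3 G.

Let sG : is_subgroup G := ggs_subgroup e.
Let nG : normalizes G G := subgroup_normalizes sG.
Let Ga : G a := @ggs_mem_a p e.
Let Gb : G b := @ggs_mem_b p e.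

Lemma gamma2_subgroup : is_subgroup gamma2. Proof. exact: commutators_subgroup. Qed.
Lemma gamma3_subgroup : is_subgroup gamma3. Proof. exact: commutators_subgroup. Qed.
Lemma gamma4_subgroup : is_subgroup gamma4. Proof. exact: commutators_subgroup. Qed.
Let s2 := gamma2_subgroup.
Let s3 := gamma3_subgroup.
Let s4 := gamma4_subgroup.

Lemma gamma2_normal : normalizes G gamma2. Proof. exact: commutators_normal. Qed.
Lemma gamma3_normal : normalizes G gamma3.
Proof. by apply: commutators_normal => //; apply: gamma2_normal. Qed.

Lemma gamma4_normal : normalizes G gamma4.
Proof. by apply: commutators_normal => //; apply: gamma3_normal. Qed.
Let n2 := gamma2_normal.
Let n3 := gamma3_normal.
Let n4 := gamma4_normal.

Lemma gamma2_sub : gamma2 `<=` G. Proof. exact: commutators_subl. Qed.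
Lemma gamma3_sub : gamma3 `<=` gamma2. Proof. exact: commutators_subl. Qed.
Lemma gamma4_sub : gamma4 `<=` gamma3. Proof. exact: commutators_subl. Qed.

Lemma gamma2_comm x y : G x -> G y -> gamma2 [~ x, y].
Proof. exact: mem_commutators. Qed.

(** Modulo gamma_3, conjugation by a fixes [b, a], so each application multiplies b by one more
    factor [b, a]. *)
Lemma beta_eqmod n : eqmod gamma3 (b ^ (a ^+ n)) (b * [~ b, a] ^+ n).
Proof.
have c2 : gamma2 [~ b, a] := gamma2_comm Gb Ga.
have cG := gamma2_sub c2.
have cX m : G ([~ b, a] ^+ m) by apply: (subgroupX _ sG).
elim: n => [|n IHn]; first by rewrite conjg1 mulg1; apply: eqmod_refl.
rewrite expgSr conjgM; apply: (eqmod_trans s3 (eqmodJ n3 Ga IHn)).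
rewrite conjMg expgSr conjXg.
have -> : b ^ a = b * [~ b, a] by rewrite commgEl mulVKg.
rewrite -expgSr expgS (mulgA b [~ b, a]); apply: (eqmodM s3 n3).
- by rewrite -conjXg; apply: (subgroupJ sG).
- exact: eqmod_refl.
have : eqmod gamma3 ([~ b, a] ^ a) [~ b, a].
  have -> : eqmod gamma3 ([~ b, a] ^ a) [~ b, a] = gamma3 [~ [~ b, a], a]^-1.
    by rewrite (commgEl [~ b, a]) invgM invgK.
  by apply: (subgroupV s3); apply: mem_commutators.
move=> ca; elim: n {IHn} => [|n IHn]; first exact: eqmod_refl.
by rewrite !expgS; apply: (eqmodM s3 n3) => //; rewrite -conjXg; apply: (subgroupJ sG).
Qed.

Lemma prod_beta_eqmod s : eqmod gamma3 (\prod_(i <- s) beta i)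
  (b ^+ size s * [~ b, a] ^+ \sum_(i <- s) ((-1 - i)%R : 'F_p)).
Proof.
have c2 : gamma2 [~ b, a] := gamma2_comm Gb Ga.
have cX m : G ([~ b, a] ^+ m) by apply: (subgroupX _ sG); apply: gamma2_sub.
have bX m : G (b ^+ m) by apply: (subgroupX _ sG).
elim: s => [|i s IH]; first by rewrite !big_nil mulg1; apply: eqmod_refl.
rewrite !big_cons expgnDr [size _]/= expgS; set t := nat_of_ord (-1 - i)%R.
have Gp : G (\prod_(j <- s) beta j) by apply: ggs_mem_prod => j; apply: ggs_mem_beta.
apply: (eqmod_trans s3 (eqmodM s3 n3 Gp (beta_eqmod t) IH)).
rewrite -!mulgA; apply: (eqmodM s3 n3); [|exact: eqmod_refl|].
  by do !apply: (subgroupM sG).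
rewrite !mulgA; apply: (eqmodM s3 n3); [exact: cX| |exact: eqmod_refl].
apply: (@eqmodC _ gamma3); apply: (commutatorC s3).
by apply: (@mem_commutators _ gamma2 G) => //; apply: (subgroupX _ s2).
Qed.

Lemma beta_section_level1 (s : seq 'F_p) j i :
  (\prod_(k <- s) beta_section e k j) [:: letter i] =
  [:: letter (i + \sum_(k <- s) f (j - k))%R].
Proof.
elim: s => [|k s IH]; first by rewrite !big_nil addr0.
rewrite !big_cons autM IH /beta_section; case: eqP => [->|_].
  by rewrite subrr exponent0 // add0r (ggs_b_node p_prime) (node_cons p_prime) aut_nil.
by rewrite (ggs_aX_letter p_prime) natr_Zp -addrA [(_ + f _)%R]addrC.
Qed.

Lemma level_stab2_gamma3 : G `&` @level_stab p 2 `<=` gamma3.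
Proof.
move=> g [Gg g2].
have [s gE] := level_stab1_form p_prime Gg (level_stab_le (leqnSn 1) g2).
have f0 : exists i, f i != f 0%R.
  have [k [l [_ _ nkl]]] := f_nonconstant.
  have [fk|] := eqVneq (f k) (f 0%R); last by exists k.
  by exists l; rewrite -fk eq_sym.
have fs j : (\sum_(i <- s) f (j - i) = 0)%R.
  move: g2; rewrite gE (prod_beta_node p_prime) => /(node_level_stab p_prime)/(_ j).
  move/(_ [:: letter 0%R] erefl); rewrite beta_section_level1 add0r => -[E].
  by apply: (can_inj (letterK p_prime)); apply: val_inj.
have [sz0 sum0] := annihilator_sums p_prime f0 fs.
(* As a^p = 1, conjugation by a^p fixes b, while modulo gamma_3 it multiplies b by [b, a]^p. *)
have c3 : gamma3 ([~ b, a] ^+ p).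
  have := beta_eqmod p; rewrite ggs_aX_p // conjg1.
  by rewrite /eqmod mulKg.
have XE x n : x ^+ p = 1 -> (n%:R = 0 :> 'F_p)%R -> x ^+ n = 1 :> autT p.
  by move=> xp n0; rewrite -(expg_Fp_nat p_prime xp) n0.
rewrite gE; apply: (eqmod1 s3 (prod_beta_eqmod s)).
rewrite XE ?ggs_bX_p // mul1g.
(* Modulo p this sum is minus the length of s minus the sum of s, and both vanish. *)
have : (p %| \sum_(i <- s) ((-1 - i)%R : 'F_p))%N.
  rewrite (dvdn_pcharf (pchar_Fp p_prime)) natr_sum.
  rewrite (eq_bigr (fun i => -1 - i)%R) => [|i _]; last by rewrite natr_Zp.
  rewrite sumrB sum0 subr0 big_const_seq count_predT iter_addr_0 mulNrn.
  by rewrite sz0 oppr0.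
by case/dvdnP => m ->; rewrite mulnC expgnA; apply: (subgroupX _ s3).
Qed.

(** * Self-similarity: sections of G and of its normal subgroups *)

Let f0 : f 0%R = 0%R. Proof. exact: (@exponent0 p p_prime e). Qed.

Lemma exponent_neq0 : exists k, (k != 0 /\ f k != 0)%R.
Proof.
have [k [l [k0 l0 nkl]]] := f_nonconstant.
have [fk|] := eqVneq (f k) 0%R; last by exists k.
by exists l; split=> //; rewrite -fk eq_sym.
Qed.

Lemma subgroup_root (H : set (autT p)) x k : is_subgroup H -> x ^+ p = 1 ->
  (k != 0)%R -> H (x ^+ k) -> H x.
Proof.
move=> sH xp k0 hx; rewrite -[x]expg1 -(expg_Fp_nat p_prime xp 1) -(mulfV k0).
by rewrite (expg_FpM p_prime xp); apply: (subgroupX _ sH).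
Qed.

Lemma ggs_sub (H : set (autT p)) : is_subgroup H -> H a -> H b -> G `<=` H.
Proof. by move=> sH ha hb; apply: generated_sub => // _ [->|->]. Qed.

Lemma beta_section_id i : beta_section e i i = b.
Proof. by rewrite /beta_section eqxx. Qed.

Lemma beta_section_neq i j : i != j -> beta_section e i j = a ^+ f (j - i)%R.
Proof. by rewrite /beta_section eq_sym => /negbTE ->. Qed.

Lemma beta_section_shift i k j :
  beta_section e (i + k)%R j = beta_section e k (j - i)%R.
Proof.
have E : (j - (i + k) = j - i - k)%R by ring.
by rewrite /beta_section -subr_eq0 E subr_eq0.
Qed.

Definition sections_at (H : set (autT p)) i :=
  [set g | exists h, H (node h) /\ h i = g].

Lemma sections_at_subgroup H i : is_subgroup H -> is_subgroup (sections_at H i).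
Proof.
move=> sH; apply/is_subgroupP; split.
- exists (fun=> 1); split=> //; rewrite node1; exact: (subgroup1 sH).
- move=> _ _ [h [Hh <-]] [k [Hk <-]]; exists (fun j => h j * k j); split=> //.
  by rewrite -nodeM; apply: (subgroupM sH).
- move=> _ [h [Hh <-]]; exists (fun j => (h j)^-1); split=> //.
  by rewrite -nodeV; apply: (subgroupV sH).
Qed.

(** At the letter i, [beta i] has section b and [beta (i - k)] has section a^(f k), which generates
    the powers of a when f k is non-zero. *)
Lemma ggs_sections i : G `<=` sections_at G i.
Proof.
have sS := sections_at_subgroup i sG.
have Gnode j : G (node (beta_section e j)) by rewrite -beta_node //; apply: ggs_mem_beta.
apply: ggs_sub => //; last first.
  by exists (beta_section e i); split; [apply: Gnode|rewrite beta_section_id].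
have [k [k0 fk0]] := exponent_neq0.
apply: (subgroup_root sS (ggs_aX_p p_prime) fk0).
exists (beta_section e (i - k)%R); split; first exact: Gnode.
rewrite beta_section_neq; first by rewrite opprB addrC subrK.
by rewrite -subr_eq0 addrAC subrr sub0r oppr_eq0.
Qed.

Lemma sections_at_normal H i : normalizes G H -> normalizes G (sections_at H i).
Proof.
move=> nH _ g /(@ggs_sections i) [k [Gk <-]] [h [Hh <-]].
by exists (fun j => h j ^ k j); split=> //; rewrite -nodeJ; apply: nH.
Qed.

Lemma single_preim_normal H i :
  normalizes G H -> normalizes G [set x | H (single i x)].
Proof.
move=> nH x g /(@ggs_sections i) [k [Gk <-]] Hx /=.
by rewrite -singleJ; apply: nH.
Qed.

(** As the first element lives below i only, the other sections of the second one disappear from the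
    commutator. *)
Lemma single_commutator A B i x y : A (single i x) -> sections_at B i y ->
  commutators A B (single i [~ x, y]).
Proof.
move=> Ax [h [Bh <-]]; rewrite -singleR.
exact: mem_commutators.
Qed.

Lemma single_move H i j x : normalizes G H -> H (single i x) -> H (single j x).
Proof.
move=> nH Hx; suff <- : single i x ^ (a ^+ (i - j)%R) = single j x.
  by apply: nH => //; apply: ggs_mem_aX.
rewrite /single (node_conj_aX p_prime); apply: eq_node => k.
have E : (k + (i - j) - i = k - j)%R by ring.
by rewrite natr_Zp -subr_eq0 E subr_eq0.
Qed.

(** All [beta i] are congruent to b modulo gamma_2, and [b x, b y] lies in gamma_3 for x, y in
    gamma_2. *)
Lemma beta_commutator i j : gamma3 [~ beta i, beta j].
Proof.
have sC := centralizer_mod_subgroup (range beta) sG s3 n3.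
have beta_eq k : beta k = b * [~ b, a ^+ (-1 - k)%R] by rewrite commgEl mulVKg.
have c2 k : gamma2 [~ b, a ^+ (-1 - k)%R] by apply: gamma2_comm => //; apply: ggs_mem_aX.
have bC k : gamma3 [~ beta k, b].
  rewrite beta_eq commMgJ commgg conj1g mul1g.
  by apply: (@mem_commutators _ gamma2 G).
suff [_] : centralizer_mod G gamma3 (range beta) (beta i) by apply; exists j.
rewrite beta_eq; apply: (subgroupM sC).
  by split=> // _ [k _ <-]; apply: (commutatorC s3).
split=> [|_ [k _ <-]]; first by apply: gamma2_sub.
by apply: (@mem_commutators _ gamma2 G) => //; apply: ggs_mem_beta.
Qed.

Lemma beta_generated_commutator x y : generated (range beta) x ->
  generated (range beta) y -> gamma3 [~ x, y].
Proof.
apply: (generated_commutator sG s3 n3).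
- by move=> _ [k _ <-]; apply: ggs_mem_beta.
- by move=> _ [k _ <-]; apply: ggs_mem_beta.
by move=> _ _ [k _ <-] [l _ <-]; apply: beta_commutator.
Qed.

(** * Branching: copies of gamma_3 in gamma_4 *)

Lemma natr_Fp_neq0 n : (0 < n < p)%N -> (n%:R != 0 :> 'F_p)%R.
Proof.
case/andP=> n0 np; apply/eqP => /(congr1 (@nat_of_ord _)).
by rewrite val_Fp_nat // modn_small //= => n0'; rewrite n0' in n0.
Qed.

Lemma exponent_geometric (m rho : 'F_p) (t : nat) :
  (m != 0)%R -> (forall k, k != 0 -> k != - m -> f (k + m) = rho * f k)%R ->
  (t < p.-1)%N -> (f (t.+1%:R * m) = rho ^+ t * f m)%R.
Proof.
move=> m0 h; elim: t => [|t IH] lt_tp; first by rewrite !mul1r.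
have p0 := prime_gt0 p_prime.
rewrite -natr1 mulrDl mul1r h ?IH 1?ltnW // ?mulrA ?exprS //.
  by rewrite mulf_neq0 // natr_Fp_neq0 //= -[p]prednK // ltnS ltnW.
rewrite -addr_eq0 -[X in (_ + X)%R]mul1r -mulrDl natr1 mulf_neq0 //.
by rewrite natr_Fp_neq0 //= -[p]prednK.
Qed.

Lemma Fp_multiple (m l : 'F_p) : (m != 0)%R -> (l != 0)%R ->
  exists2 t : nat, (t < p.-1)%N & (l = t.+1%:R * m)%R.
Proof.
move=> m0 l0; pose q : 'F_p := (l / m)%R.
have q0 : (0 < q)%N by rewrite lt0n -[_ == _]/(q == 0%R) mulf_neq0 ?invr_eq0.
exists (q : nat).-1; last by rewrite prednK // natr_Zp divfK.
have lt_qp : (q < p)%N by rewrite -[X in (_ < X)%N](Fp_cast p_prime).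
by rewrite -ltnS !prednK // prime_gt0.
Qed.

Lemma Fp_expp (x : 'F_p) : (x ^+ p = x)%R.
Proof.
rewrite -[x]natr_Zp -(pFrobenius_autE (pchar_Fp p_prime)).
exact: pFrobenius_aut_nat.
Qed.

(** Since -m = (p - 1) m, f(-m) is rho^(p-2) f(m), and rho^(p-1) = 1 when rho is non-zero. *)
Lemma exponent_geometric_opp (m rho : 'F_p) :
  (m != 0)%R -> (forall k, k != 0 -> k != - m -> f (k + m) = rho * f k)%R ->
  rho = 0%R \/ (f (- m) * rho = f m)%R.
Proof.
move=> m0 h; have [->|rho0] := eqVneq rho 0%R; [by left|right].
have p2 : (p.-2.+2 = p)%N by case: p p_prime => [|[]].
have -> : (- m = p.-2.+1%:R * m)%R.
  apply/eqP; rewrite eq_sym -addr_eq0 -[X in (_ + X)%R]mul1r -mulrDl natr1 p2.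
  by rewrite pchar_Fp_0 // mul0r.
rewrite (exponent_geometric m0 h) -?[p in (_ < p.-1)%N]p2 //.
rewrite mulrAC -exprSr; suff -> : (rho ^+ p.-2.+1 = 1)%R by rewrite mul1r.
by apply: (mulfI rho0); rewrite -exprS p2 Fp_expp mulr1.
Qed.

Lemma exponent_ratio_neq1 (m rho : 'F_p) :
  (m != 0)%R -> (forall k, k != 0 -> k != - m -> f (k + m) = rho * f k)%R ->
  (rho != 1)%R.
Proof.
move=> m0 h; apply/eqP => rho1; have [k [l [k0 l0 /eqP]]] := f_nonconstant; apply.
have [t lt_t ->] := Fp_multiple m0 k0; have [u lt_u ->] := Fp_multiple m0 l0.
by rewrite !(exponent_geometric m0 h) // rho1 !expr1n.
Qed.

(** If rho = 0 the two elements are b and a^u. If v rho = u, the second times the first is b'^(1 -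
    rho), where b' = a^u b a^(-u); so H contains b', then a^u = b'^rho (a^u b^(-rho)), then a and
    b. *)
Lemma ggs_sub_generators (H : set (autT p)) (u v rho : 'F_p) :
  is_subgroup H -> (u != 0)%R -> (rho != 1)%R ->
  rho = 0%R \/ (v * rho = u)%R ->
  H (b * (a ^+ (v * rho)%R)^-1) -> H (a ^+ u * (b ^+ rho)^-1) -> G `<=` H.
Proof.
move=> sH u0 rho1 rhoP hY hX.
case: rhoP => [rho0|vr].
  move: hX hY; rewrite rho0 mulr0 !invg1 !mulg1 => ha hb.
  by apply: ggs_sub => //; apply: (subgroup_root sH (ggs_aX_p p_prime) u0).
rewrite vr in hY.
pose b' := b ^ (a ^+ u)^-1.
have b'p : b' ^+ p = 1 by rewrite -conjXg ggs_bX_p // conj1g.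
have XY : a ^+ u * (b ^+ rho)^-1 * (b * (a ^+ u)^-1) = b' ^+ (- rho + 1)%R.
  have bp := ggs_bX_p p_prime e.
  rewrite -conjXg (expg_FpD p_prime bp) (expg_FpN p_prime bp).
  by rewrite conjgE invgK !mulgA.
have hb' : H b'.
  apply: (subgroup_root sH b'p _ (k := (- rho + 1)%R)).
    by rewrite addrC subr_eq0 eq_sym.
  by rewrite -XY; apply: (subgroupM sH).
have ha : H a.
  apply: (subgroup_root sH (ggs_aX_p p_prime) u0).
  have := subgroupM sH (subgroupX rho sH hb') hX.
  by rewrite -conjXg conjgE invgK !mulgA mulgVK mulgK.
apply: ggs_sub => //; rewrite -[b](mulgVK (a ^+ u)).
by apply: (subgroupM sH) => //; apply: (subgroupX _ sH).
Qed.

(* beta_i beta_{i+m}^{-rho} acts trivially below all but two letters i and i + m;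
   commuting two such elements whose supports share one letter isolates that
   letter. *)
Lemma branch_geometric (m rho : 'F_p) : (m != 0)%R -> (f m != 0)%R ->
  (forall k, k != 0 -> k != - m -> f (k + m) = rho * f k)%R ->
  forall x, gamma2 x -> gamma3 (single m x).
Proof.
move=> m0 fm0 h.
pose g i := beta i * (beta (i + m)%R ^+ rho)^-1.
pose s j := beta_section e 0%R j * (beta_section e m j ^+ rho)^-1.
have gE i : g i = node (fun j => s (j - i)%R).
  rewrite /g !(beta_node p_prime) nodeX nodeV nodeM; apply: eq_node => j.
  by rewrite -{1}[i]addr0 !beta_section_shift.
have sgen i : generated (range beta) (g i).
  have sB := generated_subgroup (range beta).
  apply: (subgroupM sB); first by apply: sub_generated; exists i.
  apply: (subgroupV sB); apply: (subgroupX _ sB).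
  by apply: sub_generated; exists (i + m)%R.
have ap1 := ggs_aX_p p_prime.
have s0 : s 0%R = b * (a ^+ (f (- m) * rho)%R)^-1.
  by rewrite /s beta_section_id beta_section_neq // sub0r expg_FpM.
have sm : s m = a ^+ f m * (b ^+ rho)^-1.
  by rewrite /s beta_section_id beta_section_neq 1?eq_sym // subr0.
have s1 j : (j != 0)%R -> (j != m)%R -> s j = 1.
  move=> j0 jm; rewrite /s !beta_section_neq 1?eq_sym // subr0 -expg_FpM //.
  rewrite -(expg_FpN p_prime ap1) -(expg_FpD p_prime ap1) [(f _ * _)%R]mulrC -h.
  - by rewrite subrK subrr.
  - by rewrite subr_eq0.
  - by rewrite -subr_eq0 opprK subrK.
have m2 : (m + m != 0)%R.
  rewrite -mulr2n -mulr_natl mulf_neq0 //; apply: natr_Fp_neq0 => /=.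
  by case: p p_prime p_odd => [|[|[|]]].
(* The letters 0, m carrying [g 0] and the letters m, 2m carrying [g m] have only m in common: 2m is
   non-zero, p being odd. *)
have key : [~ g 0%R, g m] = single m [~ s m, s 0%R].
  rewrite !gE nodeR; apply: eq_node => j; rewrite subr0.
  case: eqVneq => [->|jm]; first by rewrite subrr.
  have [->|j0] := eqVneq j 0%R; last by rewrite s1 // comm1g.
  by rewrite sub0r [s (- m)%R]s1 ?commg1 // ?oppr_eq0 // -subr_eq0 -opprD oppr_eq0.
pose N := [set x | gamma3 (single m x)].
have sN : is_subgroup N := single_preim_subgroup m s3.
have nN : normalizes G N := single_preim_normal n3.
have Gs j : G (s j).
  apply: (subgroupM sG); first exact: ggs_mem_beta_section.
  by apply: (subgroupV sG); apply: (subgroupX _ sG); apply: ggs_mem_beta_section.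
pose S := [set s m; s 0%R].
have Ns : N [~ s m, s 0%R] by rewrite /N /= -key; apply: beta_generated_commutator.
(* The two sections generate G, so the normal subgroup [N], containing their commutator, contains
   gamma_2. *)
have GS : G `<=` generated S.
  have sS := generated_subgroup S.
  apply: (ggs_sub_generators (u := f m) (v := f (- m)%R) (rho := rho)) => //.
  - exact: exponent_ratio_neq1 m0 h.
  - exact: exponent_geometric_opp.
  - by rewrite -s0; apply: sub_generated; right.
  - by rewrite -sm; apply: sub_generated; left.
apply: (commutators_sub sN) => x y /GS hx /GS hy.
apply: (generated_commutator sG sN nN _ _ _ hx hy).
- by move=> _ [->|->].
- by move=> _ [->|->].
move=> _ _ [->|->] [->|->] //; rewrite ?commgg; try exact: (subgroup1 sN).
exact: (commutatorC sN).
Qed.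

Lemma single_gamma3_of_gamma2 i :
  (forall x, gamma2 x -> gamma3 (single i x)) ->
  forall x, gamma3 x -> gamma4 (single i x).
Proof.
move=> h; have sN := single_preim_subgroup i s4.
apply: (commutators_sub sN) => x g hx hg /=.
by apply: (single_commutator (A := gamma3)); [apply: h|apply: ggs_sections].
Qed.

(* The commutator of beta_0 and beta_{-m} lives below the letters 0 and -m, and
   beta_i beta_{-2m}^{-c} is trivial below -m for a suitable c. *)
Lemma branch_not_geometric (m k0 : 'F_p) : (m != 0)%R -> (f m != 0)%R ->
  (k0 != 0)%R -> (k0 != - m)%R ->
  (f (k0 + m) != f (m + m) / f m * f k0)%R ->
  forall x, gamma3 x -> gamma4 (single 0%R x).
Proof.
move=> m0 fm0 k00 k0m hk0.
have ap1 := ggs_aX_p p_prime.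
have m2 : (m + m != 0)%R.
  rewrite -mulr2n -mulr_natl mulf_neq0 //; apply: natr_Fp_neq0 => /=.
  by case: p p_prime p_odd => [|[|[|]]].
(* At the letter -m, [beta i] has section a^(f(-m - i)) and [beta (-2m)] has a^(f m); this exponent
   makes them cancel. *)
pose c i := (f (- m - i) / f m)%R.
pose s i j := beta_section e i j * (beta_section e (- (m + m))%R j ^+ c i)^-1.
have sE i : node (s i) = beta i * (beta (- (m + m))%R ^+ c i)^-1.
  by rewrite !(beta_node p_prime) nodeX nodeV nodeM.
have s_m i : i != (- m)%R -> s i (- m)%R = 1.
  move=> im; rewrite /s !beta_section_neq //; last first.
    by rewrite eqr_opp -subr_eq0 addrK.
  have -> : (- m - - (m + m) = m)%R by ring.
  rewrite -expg_FpM // /c mulrC divfK //.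
  by rewrite mulgV.
have s_0 i : s i 0%R = beta_section e i 0%R * a ^+ (- (f (m + m) * c i))%R.
  rewrite /s (beta_section_neq (i := (- (m + m))%R)) ?oppr_eq0 // sub0r opprK.
  by rewrite -expg_FpM // expg_FpN.
pose c' := [~ b, a ^+ f m].
have key i : i != (- m)%R -> gamma4 (single 0%R [~ c', s i 0%R]).
  move=> im; suff <- : [~ [~ beta 0%R, beta (- m)%R], node (s i)] =
      single 0%R [~ c', s i 0%R].
    apply: (@mem_commutators _ gamma3 G); first exact: beta_commutator.
    rewrite sE; apply: (subgroupM sG); first exact: ggs_mem_beta.
    by apply: (subgroupV sG); apply: (subgroupX _ sG); apply: ggs_mem_beta.
  rewrite !(beta_node p_prime) !nodeR; apply: eq_node => j.
  case: eqVneq => [->|j0].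
    by rewrite beta_section_id beta_section_neq ?oppr_eq0 // sub0r opprK.
  have [->|jm] := eqVneq j (- m)%R; first by rewrite s_m // commg1.
  rewrite !beta_section_neq 1?eq_sym //.
  suff -> : [~ a ^+ f (j - 0)%R, a ^+ f (j - - m)%R] = 1 by rewrite comm1g.
  by apply/eqP/commgP/commuteX2/commute_refl.
pose N := [set x | gamma4 (single 0%R x)].
have sN : is_subgroup N := single_preim_subgroup 0%R s4.
have nN : normalizes G N := single_preim_normal n4.
have c'G : G c' by apply: (subgroupR sG) => //; apply: ggs_mem_aX.
have sC := centralizer_mod_subgroup [set c'] sG sN nN.
have GC : G `<=` centralizer_mod G N [set c'].
  have keyC i : i != (- m)%R -> centralizer_mod G N [set c'] (s i 0%R).
    move=> im; split=> [|_ ->]; last by apply: (commutatorC sN); apply: key.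
    rewrite s_0; apply: (subgroupM sG); last exact: ggs_mem_aX.
    exact: ggs_mem_beta_section.
  have ha : centralizer_mod G N [set c'] a.
    (* For i = -(k0 + m), the section of [s i] at 0 is a to this power, which is non-zero because
       the geometric relation fails at k0. *)
    apply: (subgroup_root sC ap1 (k := (f (k0 + m) - f (m + m) / f m * f k0)%R)).
      by rewrite subr_eq0.
    have := keyC (- (k0 + m))%R; rewrite s_0 beta_section_neq; last first.
      by rewrite oppr_eq0 addr_eq0.
    rewrite sub0r opprK -expg_FpD // /c (_ : - m - - (k0 + m) = k0)%R; last by ring.
    rewrite (_ : - (f (m + m) * (f k0 / f m)) = - (f (m + m) / f m * f k0))%R;
      last by ring.
    by apply; rewrite eqr_opp -subr_eq0 addrK.
  apply: (ggs_sub sC ha).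
  have := keyC 0%R; rewrite s_0 beta_section_id eq_sym oppr_eq0 => /(_ m0) hb.
  rewrite -[b](mulgK (a ^+ (- (f (m + m) * c 0))%R)).
  by apply: (subgroupM sC hb); apply: (subgroupV sC); apply: (subgroupX _ sC).
(* Modulo [N], c' is central, and it is the commutator of the generators b and a^(f m) of G; so
   gamma_2 is central modulo [N], and gamma_3 lies in [N]. *)
pose Z := centralizer_mod G N G.
have sZ : is_subgroup Z by apply: centralizer_mod_subgroup.
have nZ : normalizes G Z by apply: centralizer_mod_normal.
have Zc : Z c'.
  by split=> // y /GC [_ cy]; apply: (commutatorC sN); apply: cy.
have GS : G `<=` generated [set b; a ^+ f m].
  have sS := generated_subgroup [set b; a ^+ f m].
  apply: (ggs_sub sS); last by apply: sub_generated; left.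
  by apply: (subgroup_root sS ap1 fm0); apply: sub_generated; right.
have SG : [set b; a ^+ f m] `<=` G by move=> _ [->|->] //; apply: ggs_mem_aX.
have ZG x : gamma2 x -> Z x.
  apply: (commutators_sub sZ) => {}x y /GS hx /GS hy.
  apply: (generated_commutator sG sZ nZ SG SG _ hx hy).
  move=> _ _ [->|->] [->|->]; rewrite ?commgg; try exact: (subgroup1 sZ); first by [].
  exact: (commutatorC sZ).
apply: (commutators_sub sN) => x y /ZG [_ cx] /cx.
exact.
Qed.

Lemma single_gamma3 i x : gamma3 x -> gamma4 (single i x).
Proof.
have [m [m0 fm0]] := exponent_neq0.
(* The geometric relation at k = m leaves only this ratio. *)
pose rho := (f (m + m) / f m)%R.
have [h|] := pselect (forall k, k != 0 -> k != - m -> f (k + m) = rho * f k)%R.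
  move=> hx; apply: (@single_move gamma4 m _ _ n4).
  by apply: single_gamma3_of_gamma2 hx; apply: branch_geometric h.
move=> nh hx; apply: (@single_move gamma4 0%R _ _ n4); apply: contrapT => nx.
apply: nh => k k0 km; apply/eqP/negP => /negP hk; apply: nx.
exact: (branch_not_geometric m0 fm0 k0 km hk).
Qed.

(** * Level stabilizers inside gamma_4 and [gamma_3, gamma_3] *)

Lemma open_single n (A H : set (autT p)) : is_subgroup H ->
  (forall i x, A x -> H (single i x)) -> G `&` @level_stab p n `<=` A ->
  G `&` @level_stab p n.+1 `<=` H.
Proof.
move=> sH AH nA g [Gg gn].
have [s gE] := level_stab1_form p_prime Gg (level_stab_le (ltn0Sn n) gn).
(* g is the product of its pieces below single letters, whose sections lie in G and fix level n. *)
rewrite gE (prod_beta_node p_prime); apply: (node_mem sH) => i; apply/AH/nA.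
split; first by apply: ggs_mem_prod => j; apply: ggs_mem_beta_section.
by move: gn; rewrite gE (prod_beta_node p_prime) => /(node_level_stab p_prime)/(_ i).
Qed.

Lemma level_stab3_gamma4 : G `&` @level_stab p 3 `<=` gamma4.
Proof. exact: (open_single s4 single_gamma3 level_stab2_gamma3). Qed.

Definition gamma3' := commutators gamma3 gamma3.

(** As a and b generate G, gamma_2 is the normal closure of [b, a]. *)
Lemma gamma2_subset (S : set (autT p)) :
  is_subgroup S -> normalizes G S -> S [~ b, a] -> gamma2 `<=` S.
Proof.
move=> sS nS Sba; apply: (commutators_sub sS) => x y hx hy.
have sg := generated_subgroup [set a; b].
have GS : G `<=` generated [set a; b].
  by apply: (ggs_sub sg); apply: sub_generated; [left|right].
have SG : [set a; b] `<=` G by move=> _ [->|->].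
apply: (generated_commutator sG sS nS SG SG _ (GS _ hx) (GS _ hy)).
move=> _ _ [->|->] [->|->]; rewrite ?commgg; try exact: (subgroup1 sS); last by [].
exact: (commutatorC sS).
Qed.

Lemma beta_conj_a i : beta i ^ a = beta (i - 1)%R.
Proof. exact: (beta_conj_aX p_prime e i 1). Qed.

Lemma commutator_beta_a i : [~ beta i, a] = (beta i)^-1 * beta (i - 1)%R.
Proof. by rewrite commgEl beta_conj_a. Qed.

(** At i, the element [[beta_i, a], a] of gamma_3 has section x b y with x, y powers of a. Its
    conjugate y x b has the same commutator with a as b, namely [b, a], whose normal closure is
    gamma_2. *)
Lemma gamma3_sections i : gamma2 `<=` sections_at gamma3 i.
Proof.
have sS := sections_at_subgroup i s3.
have nS : normalizes G (sections_at gamma3 i) by apply: sections_at_normal.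
apply: gamma2_subset => //.
pose s j := (beta_section e (i - 1)%R j)^-1 * beta_section e i j *
  ((beta_section e (i - 1)%R j)^-1 * beta_section e (i - 2)%R j).
have sE : node s = [~ [~ beta i, a], a].
  rewrite commgEl commutator_beta_a conjMg conjVg !beta_conj_a invgM invgK.
  by rewrite -addrA -opprD !(beta_node p_prime) !nodeV !nodeM.
have sS' : sections_at gamma3 i (s i).
  exists s; split=> //; rewrite sE.
  apply: (@mem_commutators _ gamma2 G) => //.
  by apply: gamma2_comm => //; apply: ggs_mem_beta.
have n10 : (1 != 0 :> 'F_p)%R by apply: oner_neq0.
have n20 : (2%:R != 0 :> 'F_p)%R.
  by apply: natr_Fp_neq0; case: p p_prime p_odd => [|[|[|]]].
move: sS'; rewrite /s beta_section_id !beta_section_neq; last first.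
- by rewrite -subr_eq0 addrAC subrr sub0r oppr_eq0.
- by rewrite -subr_eq0 addrAC subrr sub0r oppr_eq0.
set x := (a ^+ _)^-1; set y := x * (a ^+ _) => Sy.
have Gy : G y^-1.
  by apply: (subgroupV sG); apply: (subgroupM sG); [apply: (subgroupV sG)|];
    apply: ggs_mem_aX.
have ca : commute a x by apply/commuteV/commuteX/commute_refl.
have cy : [~ y * x, a] = 1.
  apply/eqP; rewrite commg1_sym; apply/commgP/commuteM => //; apply: commuteM => //.
  exact/commuteX/commute_refl.
have Syxb : sections_at gamma3 i (y * x * b).
  by have := nS _ _ Gy Sy; rewrite conjgE invgK mulgK mulgA.
have : sections_at gamma3 i [~ y * x * b, a].
  by rewrite commgEl; apply: (subgroupM sS); [apply: (subgroupV sS)|apply: nS].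
by rewrite commMgJ cy conj1g mul1g.
Qed.

(** At i, [beta_(i-k), a] has section a^(f(k+1) - f(k)) for k other than 0 and -1, non-trivial for
    some k since [f] is not constant off 0; and [beta_i, a] has section b^(-1) a^(f 1). *)
Lemma gamma2_sections i : G `<=` sections_at gamma2 i.
Proof.
have sS := sections_at_subgroup i s2.
pose s k j := (beta_section e k j)^-1 * beta_section e (k - 1)%R j.
have sS' k : sections_at gamma2 i (s k i).
  exists (s k); split=> //; suff <- : [~ beta k, a] = node (s k).
    by apply: gamma2_comm => //; apply: ggs_mem_beta.
  by rewrite commutator_beta_a !(beta_node p_prime) nodeV nodeM.
have ap1 := ggs_aX_p p_prime.
have [k [k0 k1 fk]] : exists k : 'F_p, [/\ k != 0, k != - 1 & f (k + 1) != f k]%R.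
  apply: contrapT => no; have := @exponent_ratio_neq1 1%R 1%R (oner_neq0 _).
  suff h k : (k != 0 -> k != - 1 -> f (k + 1) = 1 * f k)%R by move/(_ h)/eqP.
  by move=> k0 k1; rewrite mul1r; apply/eqP/negP => /negP fk; apply: no; exists k.
have Sa : sections_at gamma2 i a.
  apply: (subgroup_root sS ap1 (k := (- f k + f (k + 1))%R)).
    by rewrite addrC subr_eq0.
  rewrite expg_FpD // expg_FpN //; have := sS' (i - k)%R; rewrite /s !beta_section_neq.
  - have -> : (i - (i - k) = k)%R by ring.
    by have -> : (i - (i - k - 1) = k + 1)%R by ring.
  - rewrite -subr_eq0 (_ : i - k - 1 - i = - (k + 1))%R; last by ring.
    by rewrite oppr_eq0 addr_eq0.
  - by rewrite -subr_eq0 (_ : i - k - i = - k)%R ?oppr_eq0 //; ring.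
apply: (ggs_sub sS Sa).
have := sS' i; rewrite /s beta_section_id beta_section_neq; last first.
  by rewrite -subr_eq0 addrAC subrr sub0r oppr_eq0 oner_neq0.
move=> h; rewrite -[b]invgK; apply: (subgroupV sS).
rewrite -[b^-1](mulgK (a ^+ f (i - (i - 1))%R)).
by apply: (subgroupM sS h); apply: (subgroupV sS); apply: (subgroupX _ sS).
Qed.

(** Two levels are gained from [level_stab3_gamma4]: commutators of a copy of gamma_3 with gamma_2
    give a copy of [gamma_3, G], and those with gamma_3 a copy of [gamma_3, gamma_2]. *)
Lemma level_stab5_gamma3' : G `&` @level_stab p 5 `<=` gamma3'.
Proof.
have sC : is_subgroup (commutators gamma3 gamma2) by apply: commutators_subgroup.
have sD : is_subgroup gamma3' by apply: commutators_subgroup.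
have single3 i x : gamma3 x -> gamma3 (single i x).
  by move=> hx; exact: (gamma4_sub (single_gamma3 i hx)).
apply: (open_single sD (A := commutators gamma3 gamma2)).
  move=> i; apply: (commutators_sub (single_preim_subgroup i sD)) => x y hx hy /=.
  by apply: single_commutator; [apply: single3|apply: gamma3_sections].
apply: (open_single sC (A := gamma4)); last exact: level_stab3_gamma4.
move=> i; apply: (commutators_sub (single_preim_subgroup i sC)) => x y hx hy /=.
by apply: single_commutator; [apply: single3|apply: gamma2_sections].
Qed.

(** * Non-trivial normal subgroups contain a level stabilizer *)

Lemma open_single_word m n (A H : set (autT p)) : is_subgroup H ->
  (forall v x, level m v -> A x -> H (single_word v x)) ->
  G `&` @level_stab p n `<=` A -> G `&` @level_stab p (m + n) `<=` H.
Proof.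
elim: m H => [|m IH] H sH AH nA; first by move=> g /nA; apply: (AH [::]).
apply: (open_single sH (A := [set x | forall i, H (single i x)])) => [i x|]; first exact.
move=> g hg i; apply: (IH [set x | H (single i x)]) hg => //.
  exact: single_preim_subgroup.
move=> v x hv hx /=; have := AH (letter i :: v) x; rewrite /= letterK.
by apply=> //; rewrite /level /= hv.
Qed.

Lemma single_word_gamma3 v x : gamma3 x -> gamma3 (single_word v x).
Proof.
by move=> hx; elim: v => //= c v IH; exact: (gamma4_sub (single_gamma3 _ IH)).
Qed.

Lemma level_transitive v w : size v = size w -> exists2 g, G g & g v = w.
Proof.
elim: v w => [|c v IH] [|d w] //= => [_|[/IH[g Gg gv]]].
  by exists 1 => //; apply: (subgroup1 sG).
have [h [Gh hg]] := ggs_sections (Fp_of_letter c) Gg.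
exists (a ^+ (Fp_of_letter d - Fp_of_letter c)%R * node h).
  by apply: (subgroupM sG) => //; apply: ggs_mem_aX.
rewrite autM -[c](Fp_of_letterK p_prime) (node_cons p_prime).
rewrite (Fp_of_letterK p_prime) hg gv.
rewrite -[c in LHS](Fp_of_letterK p_prime) (ggs_aX_letter p_prime).
by rewrite natr_Zp (Fp_of_letterK p_prime) addrC subrK (Fp_of_letterK p_prime).
Qed.

Lemma single_word_core (N : set (autT p)) g v x y :
  is_subgroup N -> normalizes G N -> N g -> g v != v ->
  gamma3 x -> gamma3 y -> N (single_word v [~ x, y]).
Proof.
move=> sN nN Ng gv hx hy.
have wG z : gamma3 z -> G (single_word v z).
  by move=> /(single_word_gamma3 v)/gamma3_sub/gamma2_sub.
have Gx := wG _ (subgroupV s3 hx); have Gy := wG _ hy.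
pose z := single_word v x^-1 ^ g.
have zC t : commute z (single_word v t).
  apply: (supported_below_commute (v := (g^-1)%g v) (w := v)).
  - by rewrite size_aut.
  - by apply: contra gv => /eqP {1}<-; rewrite autKV.
  - by apply/supported_belowJ/single_supported.
  - exact: single_supported.
suff -> : single_word v [~ x, y] = [~ [~ single_word v x^-1, g], single_word v y].
  rewrite commgEl [X in _ * X]/=; set h := [~ _, g].
  have Nh : N h.
    rewrite /h commgEr; apply: (subgroupM sN) => //.
    by apply: nN => //; apply: (subgroupV sN).
  by apply: (subgroupM sN); [apply: (subgroupV sN)|apply: nN].
(* With X, Y the copies of x, y below v, [X^(-1), g] = X z; as z lives below g^(-1) v, it commutes
   with Y and with [X, Y]. *)
rewrite [[~ _, g]]commgEl -/z single_wordV invgK commMgJ.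
have -> : [~ z, single_word v y] = 1 by apply/eqP/commgP.
rewrite mulg1 single_wordR; apply/esym/conjg_fixP/commgP.
by rewrite -single_wordR; apply/commute_sym.
Qed.

Lemma normal_core_open (N : set (autT p)) : is_subgroup N -> normalizes G N ->
  (exists2 g, N g & g != 1) -> exists n, G `&` @level_stab p n `<=` N.
Proof.
move=> sN nN [g Ng g1].
have [v gv] : exists v, g v != v.
  apply: contrapT => no; case/eqP: g1; apply: autT_eqP => v.
  by apply/eqP/negP => /negP gv; apply: no; exists v.
exists (size v + 5)%N.
apply: (open_single_word sN (A := gamma3')); last exact: level_stab5_gamma3'.
move=> w x hw hx.
have [t Gt tw] := level_transitive hw.
pose Nw := [set x | N (single_word w x)].
have sNw : is_subgroup Nw.
  apply/is_subgroupP; split=> /= [|y z|y].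
  - by rewrite /Nw /= single_word1; apply: (subgroup1 sN).
  - by rewrite /Nw /= single_wordM; apply: subgroupM.
  - by rewrite /Nw /= single_wordV; apply: subgroupV.
apply: (commutators_sub sNw) hx => y z hy hz.
(* As t carries w to v, which g moves, this conjugate moves w. *)
apply: (single_word_core (g := g ^ t)) => //; first exact: nN.
by rewrite !autM tw; apply: contra gv => /eqP E; rewrite -[in X in _ == X]tw -E autKV.
Qed.

(** * Subgroups of finite index *)

Lemma finite_index_core (H : set (autT p)) : is_subgroup H ->
  finite_index G H ->
  exists (I : finType) (phi : autT p -> I), forall g h x,
    G g -> G h -> phi g = phi h -> G x -> H ((g^-1 * h) ^ x).
Proof.
move=> sH /finite_seqP[s sE].
pose coset (g : autT p) : set (autT p) := [set g * h | h in H].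
have cosetP g : G g -> coset g \in s.
  move=> Gg; have : [set [set g * h | h in H] | g in G] (coset g) by exists g.
  by rewrite sE.
pose act (g : autT p) (C : set (autT p)) := [set g * h | h in C].
have actE g x : act g (coset x) = coset (g * x).
  rewrite /act /coset; apply/seteqP; split=> [_ [_ [h Hh <-] <-]|_ [h Hh <-]].
    by exists h => //; rewrite mulgA.
  by exists (x * h); [exists h|rewrite mulgA].
(* phi records the action on the cosets of H; if g and h act alike, g^(-1) h fixes every coset x H.
   The extra value [size s] is what [index] returns outside the list. *)
exists {ffun 'I_(size s) -> 'I_(size s).+1}.
exists (fun g => [ffun i : 'I_(size s) => inord (index (act g (nth set0 s i)) s)]).
move=> g h x Gg Gh /ffunP E Gx.
have lt_x : (index (coset x) s < size s)%N by rewrite index_mem cosetP.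
have := E (Ordinal lt_x); rewrite !ffunE /= nth_index ?cosetP // !actE.
move/(congr1 (@nat_of_ord _)); rewrite !inordK ?ltnS ?index_size //.
move/(congr1 (nth set0 s)).
rewrite !nth_index ?cosetP //; try exact: (subgroupM sG).
move=> EC.
have hx1 : coset (h * x) (h * x) by exists 1; [apply: (subgroup1 sH)|rewrite mulg1].
move: hx1; rewrite -EC => -[k Hk kE].
suff -> : (g^-1 * h) ^ x = k by [].
by rewrite conjgE -[g^-1 * h * x]mulgA -kE -!mulgA mulKg mulKg.
Qed.

Lemma ggs_congruence_subgroup_property : congruence_subgroup_property G.
Proof.
move=> H sH HG fiH.
pose N := [set g | forall x, G x -> H (g ^ x)].
have NH : N `<=` H by move=> g /(_ 1 (subgroup1 sG)); rewrite conjg1.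
have sN : is_subgroup N.
  apply/is_subgroupP; split=> [x Gx|g h Ng Nh x Gx|g Ng x Gx].
  - by rewrite conj1g; apply: subgroup1.
  - by rewrite conjMg; apply: (subgroupM sH); [apply: Ng|apply: Nh].
  - by rewrite conjVg; apply: (subgroupV sH); apply: Ng.
have nN : normalizes G N.
  by move=> g y Gy Ng x Gx; rewrite -conjgM; apply: Ng; apply: (subgroupM sG).
have [N1|N1] := pselect (exists2 g, N g & g != 1).
  by have [n hn] := normal_core_open sN nN N1; exists n; apply: subset_trans NH.
(* When the normal core [N] is trivial, phi is injective on G; each non-trivial element of the
   finite group G moves some level, and the largest level chosen works. *)
have [I [phi phiP]] := finite_index_core sH fiH.
have phi_inj g h : G g -> G h -> phi g = phi h -> g = h.
  move=> Gg Gh E; apply: contrapT => gh; apply: N1; exists (g^-1 * h).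
    by move=> x Gx; apply: phiP.
  by apply/eqP => /mulg1_eq; rewrite invgK.
have bound (i : I) : exists n, forall g, G g -> phi g = i -> g != 1 -> ~ level_stab n g.
  have [[g [Gg gi g1]]|no] := pselect (exists g, [/\ G g, phi g = i & g != 1]).
    have [n gn] : exists n, ~ level_stab n g.
      apply: contrapT => no; case/eqP: g1; apply: level_stab_all => n.
      by apply: contrapT => gn; apply: no; exists n.
    by exists n => h Gh hi _; rewrite (phi_inj h g) // gi.
  by exists 0%N => g Gg gi g1; case: no; exists g.
have [b_ b_P] := choice bound.
exists (\max_i b_ i)%N => g [Gg gn]; apply: contrapT => Hg.
have g1 : g != 1 by apply: contra_notN Hg => /eqP ->; apply: subgroup1.
apply: (b_P (phi g) g) => //.
exact: level_stab_le (leq_bigmax (phi g)) _ gn.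
Qed.

End GGSLowerCentral.

Theorem theoremA (p : nat) (p_prime : prime p) (p_odd : odd p)
    (e : 'rV['F_p]_(p.-1)) (e_nonconstant : nonconstant e) :
  congruence_subgroup_property (ggs e).
Proof.
apply: ggs_congruence_subgroup_property => //.
have [i [j nij]] := e_nonconstant.
have lt_p (k : 'I_p.-1) : (0 < k.+1 < p)%N.
  by rewrite /= -[X in (_ < X)%N](prednK (prime_gt0 p_prime)) ltnS.
(* Entries of [e] are counted from 0 but placed from 1 on in [exponent], position 0 holding the
   added zero. *)
exists (i.+1%:R)%R, (j.+1%:R)%R; rewrite !natr_Fp_neq0 //.
by rewrite !exponentS.
Qed.
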